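(* Let $n,p,k$ be positive integers with $k\le\min(n,p)$, $\lambda>0$, $\boldsymbol X=[\boldsymbol x_1,\dots,\boldsymbol x_p]\in\mathbb R^{n\times p}$, $\boldsymbol y\in\mathbb R^n$, and let $M_1,\dots,M_p>0$ be big-M coefficients. Define $$v_1=\min_{\boldsymbol\beta,\boldsymbol z}\left\{\tfrac1n\|\boldsymbol y-\boldsymbol X\boldsymbol\beta\|_2^2+\lambda\|\boldsymbol\beta\|_2^2:\ \sum_{i\in[p]}z_i\le k,\ |\beta_i|\le M_iz_i\ \forall i\in[p],\ \boldsymbol z\in[0,1]^p\right\},$$ $$v_2=\min_{\boldsymbol\beta,\boldsymbol\mu,\boldsymbol z}\left\{\tfrac1n\|\boldsymbol y-\boldsymbol X\boldsymbol\beta\|_2^2+\lambda\|\boldsymbol\mu\|_1:\ \beta_i^2\le\mu_iz_i\ \forall i\in[p],\ \sum_{i\in[p]}z_i\le k,\ \boldsymbol z\in[0,1]^p\right\},$$ $$v_3=\min_{\boldsymbol\beta,\boldsymbol\mu,\boldsymbol z}\left\{\tfrac1n\|\boldsymbol y-\boldsymbol X\boldsymbol\beta\|_2^2+\lambda\|\boldsymbol\mu\|_1:\ \beta_i^2\le\mu_iz_i,\ |\beta_i|\le M_iz_i\ \forall i\in[p],\ \sum_{i\in[p]}z_i\le k,\ \boldsymbol z\in[0,1]^p\right\},$$ $$v_4=\min_{\boldsymbol z}\left\{\lambda\boldsymbol y^\top\Big[n\lambda\boldsymbol I_n+\sum_{i\in[p]}z_i\boldsymbol x_i\boldsymbol x_i^\top\Big]^{-1}\boldsymbol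 y:\ \sum_{i\in[p]}z_i\le k,\ \boldsymbol z\in[0,1]^p\right\},$$ where $\boldsymbol\beta,\boldsymbol\mu\in\mathbb R^p$. Then: (i) $v_2=v_4\le v_3$; and (ii) $v_1\le v_3$.
   Context: $[p]=\{1,\dots,p\}$; $\boldsymbol I_n$ is the $n\times n$ identity matrix. The four problems are the continuous relaxations of, respectively, the big-M formulation, the mixed integer second order conic (perspective) formulation, the latter with big-M constraints added, and the mixed integer convex formulation of the sparse ridge regression problem $\min\{\frac1n\|\boldsymbol y-\boldsymbol X\boldsymbol\beta\|_2^2+\lambda\|\boldsymbol\beta\|_2^2:\|\boldsymbol\beta\|_0\le k\}$. *)

(* Defs.v *)
From mathcomp Require Import all_boot all_order all_algebra.
From mathcomp Require Import classical_sets reals.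

Set Implicit Arguments.
Unset Strict Implicit.
Unset Printing Implicit Defensive.

Import Order.TTheory GRing.Theory Num.Theory.
Local Open Scope classical_set_scope.
Local Open Scope ring_scope.

(* [v] is an attained minimum, not merely an infimum. *)
Definition is_min {R : realType} (A : set R) (v : R) : Prop :=
  A v /\ lbound A v.

(* The norm [`|_|] of MathComp-Analysis on matrices is the sup norm, hence the
   explicit 1- and 2-norms. *)
Definition norm1 {R : realType} {m : nat} (u : 'cV[R]_m) : R :=
  \sum_i `|u i 0|.

Definition norm2 {R : realType} {m : nat} (u : 'cV[R]_m) : R :=
  Num.sqrt (\sum_i u i 0 ^+ 2).

Definition relaxed_card {R : realType} {p : nat} (k : nat) (z : 'cV[R]_p) :
    Prop :=
  \sum_i z i 0 <= k%:R /\ forall i, 0 <= z i 0 <= 1.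

Definition big_M {R : realType} {p : nat} (M : 'I_p -> R) (b z : 'cV[R]_p) :
    Prop :=
  forall i, `|b i 0| <= M i * z i 0.

(* [mu] is not required to be nonnegative: when [z i 0 = 0] the entry [mu i 0]
   is free. *)
Definition perspective {R : realType} {p : nat} (b mu z : 'cV[R]_p) : Prop :=
  forall i, b i 0 ^+ 2 <= mu i 0 * z i 0.

Definition loss {R : realType} {n p : nat} (X : 'M[R]_(n, p)) (y : 'cV[R]_n)
    (b : 'cV[R]_p) : R :=
  n%:R^-1 * norm2 (y - X *m b) ^+ 2.

Section Problems.
Variables (R : realType) (n p k : nat) (lambda : R).
Variables (X : 'M[R]_(n, p)) (y : 'cV[R]_n) (M : 'I_p -> R).

Definition bigM_values : set R :=
  [set v | exists b z : 'cV[R]_p,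
    [/\ relaxed_card k z, big_M M b z
      & v = loss X y b + lambda * norm2 b ^+ 2]].

Definition conic_values : set R :=
  [set v | exists b mu z : 'cV[R]_p,
    [/\ perspective b mu z, relaxed_card k z
      & v = loss X y b + lambda * norm1 mu]].

Definition conic_bigM_values : set R :=
  [set v | exists b mu z : 'cV[R]_p,
    [/\ perspective b mu z, big_M M b z, relaxed_card k z
      & v = loss X y b + lambda * norm1 mu]].

(* [invmx] is the identity on singular matrices, but this matrix is positive
   definite whenever [0 < n], [0 < lambda] and [z] is nonnegative. *)
Definition convex_objective (z : 'cV[R]_p) : R :=
  lambda * (y^T *m invmx ((n%:R * lambda)%:M
      + \sum_i z i 0 *: (col i X *m (col i X)^T)) *m y) 0 0.

Definition convex_values : set R :=
  [set v | exists z : 'cV[R]_p, relaxed_card k z /\ v = convex_objective z].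

End Problems.

(* Main.v *)
(* Fix z in [0,1]^p, put A = n lambda I + sum_i z_i x_i x_i^T, u = A^-1 y and
   c = X^T u.  For b and mu feasible with z, the tangent inequalities
     |r|^2 / n >= 2 lambda <u, r> - n lambda^2 |u|^2   with r = y - X b,
     |mu_i| >= 2 b_i c_i - z_i c_i^2
   add up to the lower bound lambda <y, u> on the conic objective, and the choice
   b_i = z_i c_i, mu_i = z_i c_i^2 attains it because then y - X b = n lambda u.
   So for each z the conic problem minimised over (b, mu) is the convex problem,
   and v2 = v4.  The big-M constraints only shrink the feasible set, and
   b_i^2 <= mu_i z_i <= |mu_i| compares the ridge penalty with the conic one.
   Minima exist by compactness of sublevel sets; that of the convex problem is
   inherited from the conic one, so no continuity of the inverse is needed. *)
Require Import Defs.
From mathcomp Require Import all_boot all_order all_algebra.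
From mathcomp Require Import ring lra.
From mathcomp Require Import boolp classical_sets reals topology normedtype derive.

Set Implicit Arguments.
Unset Strict Implicit.
Unset Printing Implicit Defensive.

Import Order.TTheory GRing.Theory Num.Theory.
Import numFieldNormedType.Exports.
Local Open Scope classical_set_scope.
Local Open Scope ring_scope.

(** * The Euclidean inner product and its link to [norm2] *)

Definition dot {R : realType} {m : nat} (u v : 'cV[R]_m) : R :=
  \sum_i u i 0 * v i 0.

Lemma dotDr (R : realType) (m : nat) (u v w : 'cV[R]_m) :
  dot u (v + w) = dot u v + dot u w.
Proof. by rewrite -big_split; apply: eq_bigr => i _; rewrite !mxE mulrDr. Qed.

Lemma dotZr (R : realType) (m : nat) (a : R) (u v : 'cV[R]_m) :
  dot u (a *: v) = a * dot u v.
Proof. by rewrite /dot mulr_sumr; apply: eq_bigr => i _; rewrite mxE mulrCA. Qed.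

Lemma dotC (R : realType) (m : nat) (u v : 'cV[R]_m) : dot u v = dot v u.
Proof. by apply: eq_bigr => i _; rewrite mulrC. Qed.

Lemma dotE (R : realType) (m : nat) (u v : 'cV[R]_m) : dot u v = (u^T *m v) 0 0.
Proof. by rewrite mxE; apply: eq_bigr => i _; rewrite mxE. Qed.

Lemma dot_mulmx (R : realType) (m q : nat) (X : 'M[R]_(m, q)) u b :
  dot u (X *m b) = dot (X^T *m u) b.
Proof. by rewrite !dotE trmx_mul trmxK mulmxA. Qed.

Lemma dot_ge0 (R : realType) (m : nat) (u : 'cV[R]_m) : 0 <= dot u u.
Proof. by apply: sumr_ge0 => i _; rewrite -expr2 sqr_ge0. Qed.

Lemma dot_eq0 (R : realType) (m : nat) (u : 'cV[R]_m) : dot u u = 0 -> u = 0.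
Proof.
move=> /eqP; rewrite psumr_eq0 => [/allP u0|i _]; last by rewrite -expr2 sqr_ge0.
apply/colP => i; have /= := u0 i (mem_index_enum i).
by rewrite mxE mulf_eq0 orbb => /eqP.
Qed.

Lemma sqr_norm2 (R : realType) (m : nat) (u : 'cV[R]_m) : norm2 u ^+ 2 = dot u u.
Proof.
rewrite sqr_sqrtr; last by apply: sumr_ge0 => i _; rewrite sqr_ge0.
by apply: eq_bigr => i _; rewrite expr2.
Qed.

Lemma norm1_ge0 (R : realType) (m : nat) (u : 'cV[R]_m) : 0 <= norm1 u.
Proof. exact: sumr_ge0. Qed.

Lemma loss_ge0 (R : realType) (n p : nat) (X : 'M[R]_(n, p)) y b :
  0 <= loss X y b.
Proof. by rewrite mulr_ge0 ?invr_ge0 ?ler0n ?sqr_ge0. Qed.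

(** * The matrix $aI + X \mathrm{diag}(z) X^T$ and duality for fixed $z$ *)

Definition ridge_mx {R : realType} {n p : nat} (a : R) (X : 'M[R]_(n, p))
    (z : 'cV[R]_p) : 'M[R]_n :=
  a%:M + \sum_i z i 0 *: (col i X *m (col i X)^T).

Section RidgeSystem.
Variables (R : realType) (n p : nat) (X : 'M[R]_(n, p)) (z : 'cV[R]_p).

(** Each rank-one term sends $u$ to $z_i (x_i^T u) x_i$, so together they apply $X$ to the vector
    with entries $z_i (X^T u)_i$. This vector later serves as the optimal $b$. *)
Lemma ridge_mxE a u :
  ridge_mx a X z *m u = a *: u + X *m (\col_i (z i 0 * (X^T *m u) i 0)).
Proof.
rewrite mulmxDl mul_scalar_mx mulmx_suml; congr (_ + _).
apply/colP => j; rewrite summxE !mxE; apply: eq_bigr => i _.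
rewrite -scalemxAl -mulmxA !mxE big_ord1 !mxE mulrCA; congr (_ * (_ * _)).
by apply: eq_bigr => l _; rewrite !mxE.
Qed.

Lemma ridge_energy a u : dot u (ridge_mx a X z *m u) =
  a * dot u u + \sum_i z i 0 * (X^T *m u) i 0 ^+ 2.
Proof.
rewrite ridge_mxE dotDr dotZr dot_mulmx; congr (_ + _).
by apply: eq_bigr => i _; rewrite [X in _ * X]mxE expr2 mulrCA.
Qed.

Hypothesis z_ge0 : forall i, 0 <= z i 0.

(** A kernel vector has zero energy; both terms of [ridge_energy] are nonnegative, so $a |v|^2 = 0$
    and $v = 0$. *)
Lemma ridge_mx_unit a : 0 < a -> ridge_mx a X z \in unitmx.
Proof.
(* [det0P] yields a row vector in a left kernel; passing to the transposed matrix first makes [v^T]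
   a right kernel vector of the original one. *)
move=> a0; rewrite unitmxE unitfE -det_tr; apply/det0P => -[v v0].
move/(congr1 trmx); rewrite trmx_mul trmxK trmx0 => Av0.
have := ridge_energy a v^T; rewrite Av0 [LHS]big1 => [E|i _]; last first.
  by rewrite [X in _ * X]mxE mulr0.
have S0 : 0 <= \sum_i z i 0 * (X^T *m v^T) i 0 ^+ 2.
  by apply: sumr_ge0 => i _; rewrite mulr_ge0 ?sqr_ge0.
have D0 : 0 <= a * dot v^T v^T by rewrite mulr_ge0 ?dot_ge0 ?ltW.
have /eqP : a * dot v^T v^T = 0 by lra.
rewrite mulf_eq0 gt_eqF //= => /eqP/dot_eq0/(congr1 trmx).
by rewrite trmxK trmx0 => v00; rewrite v00 eqxx in v0.
Qed.

Lemma conic_weak_duality lambda y u b mu : (0 < n)%N -> 0 < lambda ->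
  perspective b mu z -> ridge_mx (n%:R * lambda) X z *m u = y ->
  lambda * dot y u <= loss X y b + lambda * norm1 mu.
Proof.
move=> n0 l0 pers yE.
have nR0 : 0 < n%:R :> R by rewrite ltr0n.
set c := X^T *m u; set r := y - X *m b.
have E : dot y u = n%:R * lambda * dot u u + \sum_i z i 0 * c i 0 ^+ 2.
  by rewrite dotC -yE ridge_energy.
have ur : dot y u = dot u r + dot c b.
  by rewrite dotC /c -dot_mulmx -dotDr subrK.
have lossP : 2 * lambda * dot u r - n%:R * lambda ^+ 2 * dot u u <= loss X y b.
  rewrite /loss sqr_norm2 -/r -(ler_pM2l nR0) mulVKf ?gt_eqF //.
  (* The tangent inequality is $|r - n\lambda u|^2 \ge 0$ expanded. *)
  suff : 0 <= \sum_i (r i 0 - n%:R * lambda * u i 0) ^+ 2.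
    have -> : \sum_i (r i 0 - n%:R * lambda * u i 0) ^+ 2 =
        dot r r - 2 * n%:R * lambda * dot u r + (n%:R * lambda) ^+ 2 * dot u u.
      rewrite /dot !mulr_sumr -sumrB -big_split /=.
      by apply: eq_bigr => i _; ring.
    by lra.
  by apply: sumr_ge0 => i _; exact: sqr_ge0.
have muP : 2 * dot c b - \sum_i z i 0 * c i 0 ^+ 2 <= norm1 mu.
  rewrite /dot /norm1 mulr_sumr -sumrB; apply: ler_sum => i _.
  (* If $z_i = 0$, the constraint forces $b_i = 0$ and leaves $\mu_i$ free, so the claim is $0 \le
     |\mu_i|$. *)
  have /= := pers i; have := z_ge0 i; rewrite le_eqVlt => /predU1P[<-|zi0].
    rewrite mulr0 => bi; have /eqP : b i 0 ^+ 2 = 0.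
      by apply/eqP; rewrite eq_le bi sqr_ge0.
    by rewrite sqrf_eq0 => /eqP ->; rewrite !(mulr0, mul0r, subr0).
  (* If $z_i > 0$, multiply by $z_i$: then $(b_i - z_i c_i)^2 \ge 0$ gives $2 b_i c_i z_i - z_i^2
     c_i^2 \le b_i^2 \le \mu_i z_i$. *)
  move=> bi; apply: le_trans (ler_norm _); rewrite -(ler_pM2r zi0).
  apply: le_trans bi; have := sqr_ge0 (b i 0 - z i 0 * c i 0); lra.
(* By [ur] the linear terms add up to $2\lambda \langle y, u\rangle$, and by [E] the subtracted
   quadratic terms are $\lambda \langle y, u\rangle$. *)
have := ler_wpM2l (ltW l0) muP; rewrite ur in E *; nra.
Qed.

Lemma conic_strong_duality lambda y u : (0 < n)%N ->
  ridge_mx (n%:R * lambda) X z *m u = y ->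
  let b := \col_i (z i 0 * (X^T *m u) i 0) in
  let mu := \col_i (z i 0 * (X^T *m u) i 0 ^+ 2) in
  perspective b mu z /\ loss X y b + lambda * norm1 mu = lambda * dot y u.
Proof.
move=> n0 yE b mu.
have nR0 : n%:R != 0 :> R by rewrite pnatr_eq0 -lt0n.
split.
  by move=> i; rewrite [b i 0]mxE [mu i 0]mxE exprMn expr2 mulrAC mulrC.
have -> : norm1 mu = \sum_i z i 0 * (X^T *m u) i 0 ^+ 2.
  by apply: eq_bigr => i _; rewrite [mu i 0]mxE ger0_norm // mulr_ge0 ?sqr_ge0.
(* The two terms of the energy of $u$, times $\lambda$, are the loss $n\lambda^2 |u|^2$ and the
   penalty. *)
rewrite dotC -{2}yE ridge_energy /loss sqr_norm2.
have -> : y - X *m b = (n%:R * lambda) *: u.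
  by rewrite -yE ridge_mxE -/b addrK.
by rewrite dotZr dotC dotZr; field.
Qed.

End RidgeSystem.

Lemma convex_objectiveE (R : realType) (n p : nat) (lambda : R)
    (X : 'M[R]_(n, p)) y z :
  convex_objective lambda X y z =
  lambda * dot y (invmx (ridge_mx (n%:R * lambda) X z) *m y).
Proof. by rewrite dotE mulmxA. Qed.

(** * Attainment of minima, continuity of objectives and closedness of constraints *)

Section Attainment.
Variable R : realType.

(** The part of [F] where [f] is at most [f w0] is closed and lies in the box $[-B, B]^m$, hence is
    compact. A minimiser there is global, since all other points of [F] have values above [f w0]. *)
Lemma attained_min (m : nat) (f : 'rV[R]_m -> R) (F : set 'rV[R]_m) w0 B :
  continuous f -> closed F -> F w0 ->
  (forall w, F w -> f w <= f w0 -> forall i, `|w 0 i| <= B) ->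
  exists2 w, F w & forall w', F w' -> f w <= f w'.
Proof.
move=> cf cF Fw0 bnd.
pose K := F `&` f @^-1` [set t | t <= f w0].
have Kw0 : K w0 by split => //=.
have cK : compact K.
  have cB : compact [set v : 'rV[R]_m | forall i, `[- B, B]%classic (v ord0 i)].
    apply: (@rV_compact R m (fun=> `[- B, B]%classic)) => i.
    exact: segment_compact.
  apply: subclosed_compact cB _ => [|w [Fw fw] i /=].
    apply: closedI => //; apply: preimage_closed; last exact: closed_le.
    by move=> ? _; exact: cf.
  by rewrite in_itv /= -ler_norml; exact: bnd.
have [|w] := @compact_EVT_min _ R f K (ex_intro _ _ Kw0) cK.
  by apply: continuous_subspaceT.
rewrite inE => -[Fw /= fw] wmin; exists w => // w' Fw'.
have [fw'|/ltW fw'] := leP (f w') (f w0); first by apply: wmin; rewrite inE.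
exact: le_trans fw'.
Qed.

Section Continuity.
Variable T : topologicalType.

Lemma continuous_sum (m : nat) (f : 'I_m -> T -> R) :
  (forall i, continuous (f i)) -> continuous (fun t => \sum_i f i t).
Proof.
move=> cf t; apply: cvg_big; first exact: add_continuous.
by move=> i _; exact: cf.
Qed.

Lemma continuous_penalized (a : R) (f g : T -> R) :
  continuous f -> continuous g -> continuous (fun t => f t + a * g t).
Proof.
move=> cf cg t; apply: cvgD; first exact: cf.
by apply: cvgM; [exact: cvg_cst|exact: cg].
Qed.

Lemma closed_le_fun (f g : T -> R) :
  continuous f -> continuous g -> closed [set t | f t <= g t].
Proof.
move=> cf cg.
have -> : [set t | f t <= g t] = (fun t => f t - g t) @^-1` [set s | s <= 0].
  by apply/funext => t /=; rewrite subr_le0.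
apply: preimage_closed; last exact: closed_le.
by move=> t _; apply: cvgB; [exact: cf|exact: cg].
Qed.

Lemma closed_forall (I : Type) (P : I -> T -> Prop) :
  (forall i, closed [set t | P i t]) -> closed [set t | forall i, P i t].
Proof.
move=> cP.
have -> : [set t | forall i, P i t] = \bigcap_(i in setT) [set t | P i t].
  by apply/funext => t; apply/propext; split => [H i _|H i]; exact: H.
by apply: closed_bigI => i _; exact: cP.
Qed.

(** Objectives and constraints are built from entries, so this form suffices; it applies directly to
    the blocks of one row vector that gathers all variables. *)
Definition entrywise_continuous {m : nat} (b : T -> 'cV[R]_m) :=
  forall i, continuous (fun t => b t i 0).

Variables (p : nat) (b mu z : T -> 'cV[R]_p).
Hypotheses (cb : entrywise_continuous b) (cmu : entrywise_continuous mu).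
Hypothesis cz : entrywise_continuous z.

Lemma continuous_sqr_norm2 : continuous (fun t => norm2 (b t) ^+ 2).
Proof.
under eq_fun do rewrite sqr_norm2.
by apply: continuous_sum => i t; apply: cvgM; exact: cb.
Qed.

Lemma continuous_norm1 : continuous (fun t => norm1 (b t)).
Proof. by apply: continuous_sum => i t; apply: cvg_norm; exact: cb. Qed.

Lemma closed_relaxed_card k : closed [set t | relaxed_card k (z t)].
Proof.
apply: closedI.
  by apply: closed_le_fun; [exact: continuous_sum|exact: cst_continuous].
apply: closed_forall => i.
rewrite (_ : mkset _ = [set t | 0 <= z t i 0] `&` [set t | z t i 0 <= 1]).
  by apply: closedI; apply: closed_le_fun => //; exact: cst_continuous.
by apply/funext => t; apply/propext; split => /= /andP.
Qed.

Lemma closed_big_M M : closed [set t | big_M M (b t) (z t)].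
Proof.
apply: closed_forall => i; apply: closed_le_fun => t.
  by apply: cvg_norm; exact: cb.
by apply: cvgM; [exact: cvg_cst|exact: cz].
Qed.

Lemma closed_perspective : closed [set t | perspective (b t) (mu t) (z t)].
Proof.
apply: closed_forall => i; apply: closed_le_fun => t.
  by apply: cvgM; exact: cb.
by apply: cvgM; [exact: cmu|exact: cz].
Qed.

End Continuity.

Lemma continuous_loss (T : topologicalType) (n p : nat) (X : 'M[R]_(n, p)) y
    (b : T -> 'cV[R]_p) :
  entrywise_continuous b -> continuous (fun t => loss X y (b t)).
Proof.
move=> cb t; apply: cvgM; first exact: cvg_cst.
apply: (@continuous_sqr_norm2 _ _ (fun s => y - X *m b s)) => i.
under eq_fun do rewrite !mxE.
move=> s; apply: cvgB; first exact: cvg_cst.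
by apply: continuous_sum => j x; apply: cvgM; [exact: cvg_cst|exact: cb].
Qed.

End Attainment.

(** * Existence of the big-M and conic minima, with the origin as reference feasible point *)

Lemma relaxed_card0 (R : realType) (p k : nat) :
  relaxed_card k (0 : 'cV[R]_p).
Proof.
split=> [|i]; last by rewrite mxE lexx ler01.
by rewrite big1 ?ler0n // => i _; rewrite mxE.
Qed.

Lemma big_M0 (R : realType) (p : nat) (M : 'I_p -> R) : big_M M 0 0.
Proof. by move=> i; rewrite !mxE normr0 mulr0. Qed.

Lemma bigM_min (R : realType) (n p k : nat) (lambda : R)
    (X : 'M[R]_(n, p)) (y : 'cV[R]_n) (M : 'I_p -> R) :
  (forall i, 0 < M i) -> exists v, is_min (bigM_values k lambda X y M) v.
Proof.
move=> hM.
pose b (w : 'rV[R]_(p + p)) : 'cV[R]_p := (lsubmx w)^T.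
pose z (w : 'rV[R]_(p + p)) : 'cV[R]_p := (rsubmx w)^T.
have cb : entrywise_continuous b.
  by move=> i; under eq_fun do rewrite !mxE; exact: coord_continuous.
have cz : entrywise_continuous z.
  by move=> i; under eq_fun do rewrite !mxE; exact: coord_continuous.
pose F := [set w | relaxed_card k (z w)] `&` [set w | big_M M (b w) (z w)].
pose f w := loss X y (b w) + lambda * norm2 (b w) ^+ 2.
(* Here the feasible set itself is bounded: $|b_i| \le M_i z_i \le M_i$ and $0 \le z_i \le 1$. *)
have [||||w [zk bM] wmin] := @attained_min R _ f F 0 (1 + \sum_i M i).
- exact: continuous_penalized (continuous_loss cb) (continuous_sqr_norm2 cb).
- by apply: closedI; [exact: closed_relaxed_card|exact: closed_big_M].
- rewrite /F /b /z /= !(linear0, trmx0).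
  by split; [exact: relaxed_card0|exact: big_M0].
- move=> w [[_ z01] bM] _ j.
  have S0 : 0 <= \sum_i M i by apply: sumr_ge0 => i _; exact: ltW.
  rewrite -(splitK j); case: (split j) => i /=.
    have := bM i; rewrite !mxE => /le_trans; apply.
    have := z01 i; rewrite !mxE => /andP[_ z1].
    apply: (@le_trans _ _ (M i)); first by rewrite ler_piMr // ltW.
    rewrite (bigD1 i) //= addrCA lerDl addr_ge0 //.
    by apply: sumr_ge0 => l _; exact: ltW.
  have := z01 i; rewrite !mxE => /andP[z0 z1].
  by rewrite ger0_norm //; apply: le_trans z1 _; rewrite lerDl.
- exists (f w); split; first by exists (b w), (z w).
  move=> _ [b' [z' [zk' bM' ->]]].
  have bE : b (row_mx b'^T z'^T) = b' by rewrite /b row_mxKl trmxK.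
  have zE : z (row_mx b'^T z'^T) = z' by rewrite /z row_mxKr trmxK.
  by have := wmin (row_mx b'^T z'^T); rewrite /F /f /= bE zE; apply.
Qed.

(* [P] is trivial for the conic problem and [big_M M] when the big-M
   constraints are added. *)
Lemma conic_min (R : realType) (n p k : nat) (lambda : R)
    (X : 'M[R]_(n, p)) (y : 'cV[R]_n) (P : 'cV[R]_p -> 'cV[R]_p -> Prop) :
  0 < lambda -> P 0 0 ->
  (forall (T : topologicalType) (b z : T -> 'cV[R]_p),
    entrywise_continuous b -> entrywise_continuous z ->
    closed [set t | P (b t) (z t)]) ->
  exists v, is_min [set v | exists b mu z : 'cV[R]_p,
    [/\ perspective b mu z, P b z, relaxed_card k z
      & v = loss X y b + lambda * norm1 mu]] v.
Proof.
move=> l0 P0 cP.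
pose b (w : 'rV[R]_(p + (p + p))) : 'cV[R]_p := (lsubmx w)^T.
pose mu (w : 'rV[R]_(p + (p + p))) : 'cV[R]_p := (lsubmx (rsubmx w))^T.
pose z (w : 'rV[R]_(p + (p + p))) : 'cV[R]_p := (rsubmx (rsubmx w))^T.
have cb : entrywise_continuous b.
  by move=> i; under eq_fun do rewrite !mxE; exact: coord_continuous.
have cmu : entrywise_continuous mu.
  by move=> i; under eq_fun do rewrite !mxE; exact: coord_continuous.
have cz : entrywise_continuous z.
  by move=> i; under eq_fun do rewrite !mxE; exact: coord_continuous.
pose F := [set w | perspective (b w) (mu w) (z w)] `&`
  ([set w | P (b w) (z w)] `&` [set w | relaxed_card k (z w)]).
pose f w := loss X y (b w) + lambda * norm1 (mu w).
(* The loss is nonnegative, so [f w <= f 0] gives $\lambda \|\mu\|_1 \le f(0)$, and [C] bounds every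
   $|\mu_i|$. The summand 1 in the radius below covers $z$ and the square root taken for $b$. *)
pose C := f 0 / lambda.
have [||||w [pers [Pw zk]] wmin] := @attained_min R _ f F 0 (1 + C).
- exact: continuous_penalized (continuous_loss cb) (continuous_norm1 cmu).
- apply: closedI; first exact: closed_perspective.
  by apply: closedI; [exact: cP|exact: closed_relaxed_card].
- rewrite /F /b /mu /z /= !(linear0, trmx0).
  split; first by move=> i; rewrite !mxE expr0n mulr0.
  by split => //; exact: relaxed_card0.
- move=> w [pers [_ [_ z01]]] fw.
  have muC i : `|mu w i 0| <= C.
    apply: (@le_trans _ _ (norm1 (mu w))).
      by rewrite /norm1 (bigD1 i) //= lerDl sumr_ge0.
    rewrite /C ler_pdivlMr // mulrC; apply: le_trans fw.
    by rewrite /f lerDr loss_ge0.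
  move=> j; rewrite -(splitK j); case: (split j) => [i|{}j] /=.
    have bi : w 0 (lshift _ i) = b w i 0 by rewrite !mxE.
    rewrite bi; have /andP[z0 z1] := z01 i.
    have C0 : 0 <= C by apply: le_trans (muC i).
    have b2 : `|b w i 0| ^+ 2 <= C.
      rewrite -normrX ger0_norm ?sqr_ge0 //; apply: le_trans (pers i) _.
      have := muC i; rewrite ler_norml => /andP[_ mC].
      apply: (@le_trans _ _ (C * z w i 0)); first exact: ler_wpM2r.
      by rewrite ler_piMr.
    (* From $t^2 \le C$ with $t, C \ge 0$ follows $t \le 1 + C$, without a square root. *)
    by have := normr_ge0 (b w i 0); nra.
  rewrite -(splitK j); case: (split j) => i /=.
    have mi : w 0 (rshift _ (lshift _ i)) = mu w i 0 by rewrite !mxE.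
    by rewrite mi; apply: le_trans (muC i) _; rewrite lerDr.
  have zi : w 0 (rshift _ (rshift _ i)) = z w i 0 by rewrite !mxE.
  rewrite zi; have /andP[z0 z1] := z01 i.
  have C0 : 0 <= C by apply: le_trans (muC i).
  by rewrite ger0_norm //; apply: le_trans z1 _; rewrite lerDl.
- exists (f w); split; first by exists (b w), (mu w), (z w).
  move=> _ [b' [mu' [z' [pers' Pw' zk' ->]]]].
  pose w' := row_mx b'^T (row_mx mu'^T z'^T).
  have bE : b w' = b' by rewrite /b row_mxKl trmxK.
  have mE : mu w' = mu' by rewrite /mu row_mxKr row_mxKl trmxK.
  have zE : z w' = z' by rewrite /z !row_mxKr trmxK.
  by have := wmin w'; rewrite /F /f /= bE mE zE; apply.
Qed.

(** * Comparison of the four optimal values *)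

Lemma sqr_norm2_perspective (R : realType) (p k : nat) (b mu z : 'cV[R]_p) :
  perspective b mu z -> relaxed_card k z -> norm2 b ^+ 2 <= norm1 mu.
Proof.
move=> pers [_ z01]; rewrite sqr_norm2; apply: ler_sum => i _.
have /andP[z0 z1] := z01 i; rewrite -expr2; apply: le_trans (pers i) _.
(* The absolute value enters before $z_i \le 1$ is used, because $\mu_i$ may be negative where $z_i
   = 0$. *)
apply: (@le_trans _ _ (`|mu i 0| * z i 0)); last by rewrite ler_piMr.
by rewrite ler_wpM2r // ler_norm.
Qed.

Theorem theorem2 (R : realType) (n p k : nat) (lambda : R)
    (X : 'M[R]_(n, p)) (y : 'cV[R]_n) (M : 'I_p -> R)
    (hn : (0 < n)%N) (hp : (0 < p)%N) (hk : (0 < k)%N)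
    (hkmin : (k <= minn n p)%N)
    (hlambda : 0 < lambda) (hM : forall i, 0 < M i) :
  exists v1 v2 v3 v4 : R,
    [/\ is_min (bigM_values k lambda X y M) v1,
        is_min (conic_values k lambda X y) v2,
        is_min (conic_bigM_values k lambda X y M) v3
      & is_min (convex_values k lambda X y) v4]
    /\ (v2 = v4 /\ v4 <= v3)
    /\ v1 <= v3.
Proof.
have [v1 v1min] := @bigM_min R n p k lambda X y M hM.
have [v3 v3min] : exists v, is_min (conic_bigM_values k lambda X y M) v.
  apply: conic_min => //; first exact: big_M0.
  by move=> T b z cb cz; exact: closed_big_M.
have [v2 v2min] : exists v, is_min (conic_values k lambda X y) v.
  have [|v [[b [mu [z [pers _ zk ->]]]] vmin]] :=
    @conic_min R n p k lambda X y (fun _ _ => True) hlambda I.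
    by move=> T b z _ _; exact: closedT.
  exists (loss X y b + lambda * norm1 mu); split; first by exists b, mu, z.
  move=> _ [b' [mu' [z' [pers' zk' ->]]]].
  by apply: vmin; exists b', mu', z'.
have ridge_sol z : relaxed_card k z ->
    ridge_mx (n%:R * lambda) X z *m
      (invmx (ridge_mx (n%:R * lambda) X z) *m y) = y.
  move=> [_ z01]; rewrite mulKVmx // ridge_mx_unit ?mulr_gt0 ?ltr0n //.
  by move=> i; have /andP[] := z01 i.
(* Strong duality realises each convex value as the value of a feasible conic point. *)
have v2convex : lbound (convex_values k lambda X y) v2.
  move=> _ [z [zk ->]]; rewrite convex_objectiveE.
  have z0 i : 0 <= z i 0 by case: zk => _ /(_ i) /andP[].
  have [pers <-] := conic_strong_duality z0 hn (ridge_sol _ zk).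
  by apply: (proj2 v2min); do 3 eexists; split.
(* The $z$ of a conic minimiser attains [v2]: weak duality bounds its convex value above by [v2],
   and [v2convex] bounds it below. *)
have v4min : is_min (convex_values k lambda X y) v2.
  split => //; have [[b [mu [z [pers zk v2E]]]] _] := v2min.
  exists z; split => //; apply/eqP; rewrite eq_le v2convex /=; last by exists z.
  have z0 i : 0 <= z i 0 by case: zk => _ /(_ i) /andP[].
  rewrite v2E convex_objectiveE.
  exact: (conic_weak_duality z0 hn hlambda pers (ridge_sol _ zk)).
exists v1, v2, v3, v2; split => //.
have [[b [mu [z [pers bM zk ->]]]] _] := v3min.
split; first by split => //; apply: (proj2 v2min); exists b, mu, z.
(* Dropping $\mu$ from the minimiser for [v3] leaves a feasible point of the big-M problem. *)
apply: (@le_trans _ _ (loss X y b + lambda * norm2 b ^+ 2)).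
  by apply: (proj2 v1min); exists b, z.
by rewrite lerD2l ler_pM2l //; exact: sqr_norm2_perspective pers zk.
Qed.
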